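(* Let $q \in \{1,2\}$. Let $\mathcal{I}' = (F, C', d, k, m', S_0)$ be an extended instance that is $(\rho, \delta, U)$-sparse with respect to some solution $(S^*, C'^* )$ of $\mathcal{I}'$ with $S^* \supseteq S_0$, for some $\rho, \delta \in (0,1/2)$ and $U \geq 0$. Let $U' \leq U$ be the cost of $(S^*, C'^* )$ for $\mathcal{I}'$. Then, given $\mathcal{I}', \rho, \delta, U$, one can in polynomial time find a vector $R = (R_j)_{j \in C'} \in \mathbb{R}_{\geq 0}^{C'}$ such that: (a) for every $t > 0$ and every $p \in F \cup C'$, $$\left|\left\{ j \in \mathrm{Ball}_{C'}\!\left(p, \tfrac{\delta t}{4 + 3\delta}\right) : R_j \geq t \right\}\right| \leq \frac{\rho(1+3\delta/4)^q}{(1-\delta/4)^q}\cdot\frac{U}{t^q};$$ (b) there exists a solution to $\mathcal{I}'$ of cost at most $(1+\delta/2)^q U'$ in which every connected client $j$, connected to facility $i$, satisfies $d(i,j) \leq R_j$; moreover, in this solution the total cost of the clients connected to any facility $i \notin S_0$ is at most $\rho(1+\delta/2)^q U$.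
   Context: An extended instance $(F, C', d, k, m', S_0)$ consists of finite sets $C'$ (clients) and $F$ (facilities), a metric $d$ on $F \cup C'$, integers $k, m'$ and $S_0 \subseteq F$. A solution consists of a set $S \subseteq F$ of open facilities with $S_0 \subseteq S$ and $|S| \leq k$, and a set of at least $m'$ connected clients, each connected to an open facility; the cost is $\sum_j d^q(j, i_j)$ over connected clients $j$, with $i_j$ the facility $j$ is connected to (for a pair $(S,C'^* )$ each client is connected to its nearest facility in $S$). $q=1$ for Robust $k$-Median, $q=2$ for Robust $k$-Means. $\mathrm{Ball}_P(p,r) = \{p' \in P : d(p,p') \leq r\}$. For $S^* \subseteq F$, $\kappa^*_p = \arg\min_{i\in S^*} d(i,p)$ and $c^*_p = \min_{i \in S^*} d(i,p)$ for $p \in F \cup C'$. $\mathcal{I}'$ is $(\rho,\delta,U)$-sparse w.r.t. a solution $(S^*, C'^* )$ of cost at most $U$ if (i) for every $i \in S^* \setminus S_0$, $\sum_{j \in C'^*: \kappa^*_j = i}(c^*_j)^q \leq \rho U$, and (ii) for every $p \in F \cup C'$, $|\mathrm{Ball}_{C'^*}(p, \delta c^*_p)|\cdot (c^*_p)^q \leq \rho U$. *)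

(* Defs.v *)
From mathcomp Require Import all_boot all_order all_algebra.

Set Implicit Arguments.
Unset Strict Implicit.
Unset Printing Implicit Defensive.

Import Order.TTheory GRing.Theory Num.Theory.
Local Open Scope ring_scope.

(** * Extended instances and sparsity *)

(* The point type V is the union of F and C'; F and C' may overlap. *)
Record instance (R : realFieldType) (V : finType) := Instance {
  facilities : {set V};
  clients : {set V};
  dist : V -> V -> R;
  budget : int;
  demand : int;
  preopened : {set V};
  points_cover : facilities :|: clients = [set: V];
  dist_eq0 : forall x y, dist x y = 0 <-> x = y;
  dist_sym : forall x y, dist x y = dist y x;
  dist_triangle : forall x y z, dist x z <= dist x y + dist y z;
  preopened_sub : preopened \subset facilities
}.

Section Instances.
Variables (R : realFieldType) (V : finType) (I : instance R V).

Definition Ball (P : {set V}) (p : V) (r : R) : {set V} :=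
  [set p' in P | dist I p p' <= r].

(* The client j in D is connected to the facility sigma j; the values of sigma
   outside D are irrelevant. *)
Definition solution (S D : {set V}) (sigma : V -> V) : Prop :=
  [/\ preopened I \subset S /\ S \subset facilities I,
      (#|S|%:Z <= budget I)%R,
      D \subset clients I,
      (demand I <= #|D|%:Z)%R
    & forall j, j \in D -> sigma j \in S].

Definition cost (q : nat) (D : {set V}) (sigma : V -> V) : R :=
  \sum_(j in D) dist I j (sigma j) ^+ q.

(* kappa is an argmin map p |-> argmin_(i in S) d(i, p), ties being broken
   arbitrarily.  No condition is imposed when S is empty. *)
Definition nearest (S : {set V}) (kappa : V -> V) : Prop :=
  forall p i, i \in S -> kappa p \in S /\ dist I (kappa p) p <= dist I i p.

(* dist I (kappa p) p is c*_p.  If S is empty, a solution has D empty, so that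
   both conditions then hold whatever kappa is. *)
Definition sparse (q : nat) (rho delta U : R) (S D : {set V})
    (kappa : V -> V) : Prop :=
  (forall i, i \in S :\: preopened I ->
     \sum_(j in D | kappa j == i) dist I (kappa j) j ^+ q <= rho * U) /\
  (forall p : V,
     #|Ball D p (delta * dist I (kappa p) p)|%:R * dist I (kappa p) p ^+ q
       <= rho * U).

End Instances.

(** * A random access machine over an ordered field *)

(* Programs do not mention the field, so one program runs over every field.
   Index registers support only copy and successor; hence their contents never
   exceed the largest initial index plus the running time, and charging one
   unit per index operation is honest. *)
Inductive iexp := IConst of nat | IReg of nat | ISucc of iexp.

Inductive nop := NAdd | NSub | NMul | NDiv.

(* NCell a i j reads entry (i, j) of the array number a. *)
Inductive nexp :=
  | NConst of nat
  | NCell of nat & iexp & iexp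
  | NOp of nop & nexp & nexp.

Inductive bexp :=
  | BILt of iexp & iexp
  | BNLe of nexp & nexp
  | BNot of bexp
  | BAnd of bexp & bexp.

Inductive cmd :=
  | Skip
  | SetReg of nat & iexp
  | SetCell of nat & iexp & iexp & nexp
  | Seq of cmd & cmd
  | If of bexp & cmd & cmd
  | While of bexp & cmd.

Section Machine.
Variables (R : realFieldType) (sz : R -> nat).

Record state := State {
  reg : nat -> nat;
  cell : nat -> nat -> nat -> R
}.

Definition set_reg (s : state) (x v : nat) : state :=
  State (fun y => if y == x then v else reg s y) (cell s).

Definition set_cell (s : state) (a i j : nat) (v : R) : state :=
  State (reg s)
    (fun a' i' j' => if [&& a' == a, i' == i & j' == j] then v
                     else cell s a' i' j').

Fixpoint ieval (s : state) (e : iexp) : nat :=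
  match e with
  | IConst n => n
  | IReg x => reg s x
  | ISucc e => (ieval s e).+1
  end.

Definition nop_eval (o : nop) (x y : R) : R :=
  match o with
  | NAdd => x + y
  | NSub => x - y
  | NMul => x * y
  | NDiv => x / y
  end.

Fixpoint neval (s : state) (e : nexp) : R :=
  match e with
  | NConst n => n%:R
  | NCell a i j => cell s a (ieval s i) (ieval s j)
  | NOp o e1 e2 => nop_eval o (neval s e1) (neval s e2)
  end.

Fixpoint beval (s : state) (b : bexp) : bool :=
  match b with
  | BILt i j => (ieval s i < ieval s j)%N
  | BNLe e1 e2 => neval s e1 <= neval s e2
  | BNot b => ~~ beval s b
  | BAnd b1 b2 => beval s b1 && beval s b2
  end.

Fixpoint icost (e : iexp) : nat :=
  match e with
  | ISucc e => (icost e).+1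
  | _ => 1%N
  end.

(* Every number read from memory or produced by an arithmetic operation is
   charged 1 plus its size sz. *)
Fixpoint ncost (s : state) (e : nexp) : nat :=
  (1 + sz (neval s e) +
   match e with
   | NConst _ => 0
   | NCell _ i j => icost i + icost j
   | NOp _ e1 e2 => ncost s e1 + ncost s e2
   end)%N.

Fixpoint bcost (s : state) (b : bexp) : nat :=
  (1 + match b with
       | BILt i j => icost i + icost j
       | BNLe e1 e2 => ncost s e1 + ncost s e2
       | BNot b => bcost s b
       | BAnd b1 b2 => bcost s b1 + bcost s b2
       end)%N.

(* exec c s T s' : started in s, the program c halts in s' after time T. *)
Inductive exec : cmd -> state -> nat -> state -> Prop :=
  | ESkip s : exec Skip s 1 s
  | ESetReg x e s :
      exec (SetReg x e) s (1 + icost e) (set_reg s x (ieval s e))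
  | ESetCell a i j e s :
      exec (SetCell a i j e) s (1 + icost i + icost j + ncost s e)
        (set_cell s a (ieval s i) (ieval s j) (neval s e))
  | ESeq c1 c2 s1 s2 s3 T1 T2 :
      exec c1 s1 T1 s2 -> exec c2 s2 T2 s3 ->
      exec (Seq c1 c2) s1 (1 + T1 + T2) s3
  | EIf b c1 c2 s T s' :
      exec (if beval s b then c1 else c2) s T s' ->
      exec (If b c1 c2) s (1 + bcost s b + T) s'
  | EWhileF b c s :
      ~~ beval s b -> exec (While b c) s (1 + bcost s b) s
  | EWhileT b c s1 s2 s3 T1 T2 :
      beval s1 b -> exec c s1 T1 s2 -> exec (While b c) s2 T2 s3 ->
      exec (While b c) s1 (1 + bcost s1 b + T1 + T2) s3.

End Machine.

(* Number of binary digits of the numerator and of the denominator. *)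
Definition rat_bits (x : rat) : nat :=
  (up_log 2 `|numq x|.+1 + up_log 2 `|denq x|.+1)%N.

(* Running times are measured in two ways: arithmetic operations at unit cost,
   over any ordered field; and, for rational data, bit complexity (logarithmic
   cost, polynomially equivalent to Turing machine time). *)
Inductive cost_model : forall R : realFieldType, (R -> nat) -> Prop :=
  | unit_cost (R : realFieldType) : @cost_model R (fun=> 0%N)
  | bit_cost : @cost_model rat rat_bits.

(** * Input and output conventions *)

Section Encoding.
Variables (R : realFieldType) (sz : R -> nat) (V : finType).
Variables (I : instance R V) (rho delta U : R).

(* The points are numbered 0, ..., #|V| - 1 by enum V. *)
Definition flag_cells (A : {set V}) (i : nat) : R :=
  if onth (enum V) i is Some p then (p \in A)%:R else 0.

Definition dist_cells (i j : nat) : R :=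
  match onth (enum V) i, onth (enum V) j with
  | Some p, Some p' => dist I p p'
  | _, _ => 0
  end.

Definition parameters : seq R :=
  [:: (budget I)%:~R; (demand I)%:~R; rho; delta; U].

(* Register 0 holds the number of points; array 0 holds the distances, arrays
   1, 2, 3 the characteristic vectors of F, C', S_0 (in column 0), and array 4
   the parameters (in column 0).  Everything else is 0. *)
Definition input : state R :=
  State (fun x => if x == 0%N then #|V| else 0%N)
    (fun a i j =>
       match a, j with
       | 0%N, _ => dist_cells i j
       | 1%N, 0%N => flag_cells (facilities I) i
       | 2%N, 0%N => flag_cells (clients I) i
       | 3%N, 0%N => flag_cells (preopened I) i
       | 4%N, 0%N => nth 0 parameters i
       | _, _ => 0
       end).

(* The flags are charged one unit each. *)
Definition input_size : nat :=
  (\sum_(p : V) \sum_(p' : V) (1 + sz (dist I p p')) + 3 * #|V|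
   + \sum_(x <- parameters) (1 + sz x))%N.

(* The entry of the output vector at p is left in column 0 of array 5. *)
Definition output (s : state R) (p : V) : R := cell s 5 (enum_rank p) 0.

End Encoding.

(* Main.v *)
(* Go through the positive distances c in decreasing order. At level c, give a
   client j with R_j = 0 the value R_j = (1 + 3 delta/4) c as long as no ball
   B(p, delta c/4) then violates (a); raising values at a level never
   endangers (a) at the levels above, nor, the balls being smaller and the
   bound larger, at those below.

   For (b), treat the clients of C'* by increasing c*_j. If the client j is
   given less than (1 + 3 delta/4) c*_j, it was refused because of a ball
   B(p, delta c*_j/4) containing j that is full at level c*_j. By sparsity
   B(p, delta c*_p) contains no more clients of C'* than there are clients of
   value at least (1 + 3 delta/4) c*_j in the full ball; a substitute already
   chosen there stands for a client of C'* in B(p, delta c*_p), other than j.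
   Hence one of these clients is still free, and it replaces j at distance at
   most delta c*_j/2. *)
Require Import Defs.
From mathcomp Require Import all_boot all_order all_algebra.
From mathcomp Require Import zify ring lra.

Set Implicit Arguments.
Unset Strict Implicit.
Unset Printing Implicit Defensive.

Import Order.TTheory GRing.Theory Num.Theory.
Local Open Scope ring_scope.

(** * Exchange and greedy arguments *)

Section Sparsification.
Variables (R : realFieldType) (V : finType) (I : instance R V).
Variables (q : nat) (rho delta U : R).
Hypotheses (rho_gt0 : 0 < rho) (delta_gt0 : 0 < delta).
Hypotheses (delta_lt : delta < 2^-1) (U_ge0 : 0 <= U).

Local Notation d := (dist I).
Local Notation clients := (clients I).

Lemma dist_refl x : d x x = 0.
Proof. exact: (proj2 (dist_eq0 I x x) erefl). Qed.

Lemma dist_ge0 x y : 0 <= d x y.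
Proof.
have := dist_triangle I x y x; rewrite dist_refl (dist_sym I y).
by lra.
Qed.

Ltac dlra := have := rho_gt0; have := delta_gt0; have := delta_lt; lra.

(* For t = radius c one has delta t / (4 + 3 delta) = delta c / 4, so that
   condition (a) at t reads: fits c #|heavy Rv c p|. *)
Definition radius (c : R) : R := (4 + 3 * delta) / 4 * c.

Definition heavy (Rv : V -> R) (c : R) (p : V) : {set V} :=
  [set j in Ball I clients p (delta / 4 * c) | radius c <= Rv j].

(** If [p] is within [delta / 4 * c] of a client whose connection cost is [c], then c*_p is at least
    [(4 - delta) / 4 * c]; sparsity at [p] then bounds a count in this form. *)
Definition fits (c : R) (n : nat) : bool :=
  n%:R * ((4 - delta) / 4 * c) ^+ q <= rho * U.

(** Maximality of the greedy choice at level [c]: each client left below [radius c] lies in a ball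
    that has no room for one more. *)
Definition saturated (Rv : V -> R) (c : R) : Prop :=
  forall j, j \in clients -> Rv j < radius c ->
  exists2 p, d p j <= delta / 4 * c & ~~ fits c #|heavy Rv c p|.+1.

Lemma radius_lt (c c' : R) : (radius c < radius c') = (c < c').
Proof. by rewrite /radius ltr_pM2l //; dlra. Qed.

Lemma radius_le (c c' : R) : (radius c <= radius c') = (c <= c').
Proof. by rewrite /radius ler_pM2l //; dlra. Qed.

Lemma radius0 : radius 0 = 0. Proof. by rewrite /radius mulr0. Qed.

Lemma fits_le (c : R) (m n : nat) :
  0 <= c -> (m <= n)%N -> fits c n -> fits c m.
Proof.
move=> c0 mn; apply: le_trans; rewrite ler_wpM2r ?ler_nat //.
by rewrite exprn_ge0 // mulr_ge0 //; dlra.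
Qed.

Lemma fits_scale (c c' : R) (n : nat) :
  0 <= c -> c <= c' -> fits c' n -> fits c n.
Proof.
move=> c0 cc; apply: le_trans; rewrite ler_wpM2l //.
have h : 0 <= (4 - delta) / 4 by dlra.
by rewrite lerXn2r ?nnegrE ?ler_wpM2l // mulr_ge0 // (le_trans c0).
Qed.

Lemma radius_gt0 (c : R) : (0 < radius c) = (0 < c).
Proof. by rewrite -{1}radius0 radius_lt. Qed.

(** * Exchange argument for condition (b) *)

Section Exchange.
Variables (S C : {set V}) (kappa : V -> V) (Rv : V -> R).
Hypothesis solC : solution I S C kappa.
Hypothesis nearK : nearest I S kappa.
Hypothesis sparseC : sparse I q rho delta U S C kappa.
Hypothesis Rv_ge0 : forall j, j \in clients -> 0 <= Rv j.
Hypothesis satR : forall x y, 0 < d x y -> saturated Rv (d x y).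

Local Notation c j := (d (kappa j) j).

(* X is the set of clients already treated, by increasing connection cost;
   h j is the client serving as a substitute for j. *)
Definition exchange (X : {set V}) (h : V -> V) : Prop :=
  [/\ {in C &, injective h},
      forall j, j \in C -> h j \in clients /\ d j (h j) <= delta / 2 * c j,
      forall j, j \in X -> radius (c j) <= Rv (h j),
      forall j, j \notin X -> h j = j
    & forall x y, x \in X -> y \in C :\: X -> c x <= c y].

(** A counting argument: if all of the full ball [A] were taken, the clients of [C] whose images
    under [h] cover [A] would lie in [B] without [j], and these are fewer than [A]. Untreated
    clients count as taken, since [h] fixes them. *)
Lemma exchange_candidate (X : {set V}) (h : V -> V) (j : V) :
  exchange X h -> j \in C :\: X -> Rv j < radius (c j) ->
  exists j', [/\ j' \in clients, j' \notin h @: C, radius (c j) <= Rv j'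
               & d j j' <= delta / 2 * c j].
Proof.
move=> [hinj hC hX hid hord] jCX Rj.
have [jX jC] : j \notin X /\ j \in C by move: jCX; rewrite inE => /andP[].
have [[_ _] _ CI _ kS] := solC; have [_ sp2] := sparseC.
have jcl : j \in clients by apply: (subsetP CI).
(* Saturation is available at positive distances only; connection cost 0 would force [Rv j < 0]. *)
have c_gt0 : 0 < c j.
  rewrite lt_def dist_ge0 andbT; apply: contraTneq Rj => ->.
  by rewrite radius0 -leNgt Rv_ge0.
have [p pj] := satR c_gt0 jcl Rj.
set A := heavy _ _ _ => nfit.
(* The facility nearest to [p] also competes for [j], so c*_j exceeds c*_p by at most [d p j]. The
   facility [kappa j] shows that [S] is nonempty, as [nearest] demands. *)
have cp : (4 - delta) / 4 * c j <= c p.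
  have [kpS _] := nearK p (kS j jC); have [_ le1] := nearK j kpS.
  by have := dist_triangle I (kappa p) p j; move: pj le1; dlra.
pose B := Ball I C p (delta * c p).
(* Here 3/4 = 1/4 + 1/2: the radius of the full ball plus the displacement allowed to [h]. As
   [delta < 1/2], the factor [(4 - delta) / 4] exceeds 3/4. *)
have c_lt : 3 / 4 * (delta * c j) <= delta * c p.
  rewrite mulrCA ler_pM2l //; apply: le_trans cp.
  by rewrite ler_pM2r //; dlra.
have fitB : fits (c j) #|B|.
  apply: le_trans (sp2 p); rewrite ler_wpM2l // lerXn2r ?nnegrE ?dist_ge0 //.
  by rewrite mulr_ge0 ?dist_ge0 //; dlra.
have BA : (#|B| <= #|A|)%N.
  rewrite leqNgt; apply: contra nfit => BA.
  by apply: fits_le fitB => //; apply: ltW.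
have dc_ge0 : 0 <= delta * c j by rewrite mulr_ge0 // ltW.
have jB : j \in B by rewrite inE jC; move: pj c_lt dc_ge0; dlra.
have [j' j'A j'h] : exists2 j', j' \in A & j' \notin h @: C.
  apply/subsetPn; apply/negP => AC.
  pose Z := [set i in C | h i \in A].
  have AZ : A \subset h @: Z.
    apply/subsetP => a aA; have /imsetP[i iC aE] := subsetP AC a aA.
    by rewrite aE imset_f // inE iC -aE.
  have ZB : Z \subset B :\ j.
    apply/subsetP => i; rewrite !inE => /andP[iC /andP[/andP[_ hp] hR]].
    rewrite iC /=; apply/andP; split.
      (* The untreated [j] is its own image, but its value is too small for [A]. *)
      by apply: contraTneq hR => ->; rewrite hid // -ltNge.
    have [iX|iX] := boolP (i \in X); last first.
      by move: hp; rewrite hid //; move: c_lt dc_ge0; dlra.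
    have [_ di] := hC i iC; have ci := hord _ _ iX jCX.
    have : delta / 2 * c i <= delta / 2 * c j by rewrite ler_pM2l //; dlra.
    have := dist_triangle I p (h i) i; rewrite (dist_sym I (h i)).
    by move: hp di c_lt; dlra.
  have := subset_leq_card AZ; rewrite leqNgt => /negP; apply.
  apply: leq_ltn_trans (leq_imset_card _ _) _.
  apply: leq_ltn_trans (subset_leq_card ZB) _.
  by apply: leq_trans BA; rewrite (cardsD1 j B) jB.
exists j'; move: j'A; rewrite !inE => /andP[/andP[j'c j'p] j'R]; split=> //.
by have := dist_triangle I j p j'; rewrite (dist_sym I j p); move: pj j'p; dlra.
Qed.

(** Taking an untreated client of least connection cost preserves the order condition. It keeps
    itself if its value suffices and otherwise receives a free candidate. *)
Lemma exchange_step (X : {set V}) (h : V -> V) :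
  exchange X h -> X \subset C -> ~~ (C \subset X) ->
  exists j h', j \in C :\: X /\ exchange (j |: X) h'.
Proof.
move=> ex XC /subsetPn[j0 j0C j0X].
have j0P : j0 \in C :\: X by rewrite inE j0X.
case: (arg_minP (fun j => c j) j0P) => j jCX' jmin.
have jCX : j \in C :\: X := jCX'.
have [jX jC] : j \notin X /\ j \in C by move: jCX; rewrite inE => /andP[].
have ord x y : x \in j |: X -> y \in C :\: (j |: X) -> c x <= c y.
  rewrite !inE negb_or => xX /andP[/andP[yj yX] yC].
  have yCX : y \in C :\: X by rewrite inE yX.
  case/orP: xX => [/eqP->|xX]; first exact: jmin.
  by case: ex => _ _ _ _; apply.
have [Rj|Rj] := leP (radius (c j)) (Rv j).
  exists j, h; split=> //; case: ex => hinj hC hX hid _; split=> //.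
    by move=> i; rewrite !inE => /orP[/eqP->|/hX//]; rewrite hid.
  by move=> i; rewrite !inE negb_or => /andP[_ /hid].
have [j' [j'c j'h j'R jj']] := exchange_candidate ex jCX Rj.
exists j, [eta h with j |-> j']; split=> //.
case: ex => hinj hC hX hid _; split=> //=.
- move=> x y xC yC /=; case: eqVneq => [->|_]; case: eqVneq => [->|_] //.
  + by move=> E; case/negP: j'h; rewrite E imset_f.
  + by move=> E; case/negP: j'h; rewrite -E imset_f.
  + exact: hinj.
- by move=> i iC; case: eqVneq => [->|_] //; apply: hC.
- by move=> i; rewrite !inE; case: eqVneq => [->|_] //=; apply: hX.
- by move=> i; rewrite !inE negb_or; case: eqVneq => [->|_] //=; apply: hid.
Qed.

Lemma exchange_complete : exists h, exchange C h.
Proof.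
have [[_ _] _ CI _ _] := solC.
suff H n X h : (#|C :\: X| <= n)%N -> X \subset C -> exchange X h ->
    exists h', exchange C h'.
  apply: (H #|C| set0 id); rewrite ?setD0 ?sub0set //; split=> //.
  - move=> j jC; rewrite (subsetP CI) // dist_refl mulr_ge0 ?dist_ge0 //; dlra.
  - by move=> j; rewrite inE.
  - by move=> x y; rewrite inE.
elim: n X h => [|n IH] X h.
  rewrite leqn0 cards_eq0 setD_eq0 => CX XC ex; exists h.
  suff -> : C = X by [].
  by apply/eqP; rewrite eqEsubset CX.
move=> Xn XC ex; have [CX|CX] := boolP (C \subset X).
  apply: (IH X h) => //; move: CX; rewrite -setD_eq0 => /eqP->.
  by rewrite cards0.
have [j [h' [jCX ex']]] := exchange_step ex XC CX.
apply: (IH _ _ _ _ ex').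
  rewrite setUC -setDDl -ltnS; apply: leq_trans Xn.
  by rewrite [X in (_ < X)%N](cardsD1 j) jCX.
by rewrite subUset sub1set XC andbT; move: jCX; rewrite inE => /andP[].
Qed.

(** The open facilities stay the same, and [h j] inherits the facility of [j]. The detour of
    [delta / 2 * c j] multiplies each distance by at most [1 + delta / 2], which is below the factor
    [1 + 3 * delta / 4] in [radius]. *)
Lemma exchange_solution :
  exists (S' D : {set V}) (sigma : V -> V),
    [/\ solution I S' D sigma,
        cost I q D sigma <= (1 + delta / 2) ^+ q * cost I q C kappa,
        forall j, j \in D -> d (sigma j) j <= Rv j
      & forall i, i \in facilities I :\: preopened I ->
          \sum_(j in D | sigma j == i) d j i ^+ q
            <= rho * (1 + delta / 2) ^+ q * U].
Proof.
have [h [hinj hC hX _ _]] := exchange_complete.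
have [SF Sk CI Cm kS] := solC; have [sp1 _] := sparseC.
(* An inverse of [h] on its image; the default value elsewhere is irrelevant. *)
pose g v := odflt v [pick j in C | h j == v].
have gh : {in C, cancel h g}.
  move=> j jC; rewrite /g; case: pickP => [i /andP[iC /eqP/hinj->//]|].
  by move/(_ j); rewrite jC eqxx.
have hk j : j \in C -> d (h j) (kappa j) <= (1 + delta / 2) * c j.
  move=> jC; have [_ dj] := hC j jC.
  have := dist_triangle I (h j) j (kappa j).
  by rewrite (dist_sym I (h j) j) (dist_sym I j (kappa j)); move: dj; dlra.
have hkq j : j \in C ->
    d (h j) (kappa j) ^+ q <= (1 + delta / 2) ^+ q * c j ^+ q.
  move=> jC; rewrite -exprMn lerXn2r ?nnegrE ?dist_ge0 ?hk //.
  by rewrite mulr_ge0 ?dist_ge0 //; dlra.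
exists S, (h @: C), (kappa \o g); split.
- split=> //.
  + by apply/subsetP => _ /imsetP[j jC ->]; case: (hC j jC).
  + by rewrite card_in_imset.
  + by move=> _ /imsetP[j jC ->] /=; rewrite gh // kS.
- rewrite /cost big_imset //= mulr_sumr; apply: ler_sum => j jC.
  by rewrite gh // (dist_sym I j) hkq.
- move=> _ /imsetP[j jC ->] /=; rewrite gh // dist_sym.
  apply: le_trans (hk j jC) _; apply: le_trans (hX j jC).
  by rewrite ler_wpM2r ?dist_ge0 //; dlra.
- move=> i; rewrite inE => /andP[iP iF].
  rewrite big_imset_cond //=.
  (* A facility outside [S] serves nobody, so its sum is empty. *)
  have [iS|iS] := boolP (i \in S); last first.
    rewrite big1; first by rewrite !mulr_ge0 ?exprn_ge0 //; dlra.
    move=> j /andP[jC /eqP kj]; case/negP: iS.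
    by rewrite -kj gh // kS.
  have iSP : i \in S :\: preopened I by rewrite inE iP.
  have dq : 0 <= (1 + delta / 2) ^+ q by rewrite exprn_ge0 //; dlra.
  rewrite mulrAC mulrC; apply: le_trans (ler_wpM2l dq (sp1 i iSP)).
  rewrite mulr_sumr !big_mkcondr; apply: ler_sum => j jC; rewrite gh //.
  by case: eqP => // <-; exact: hkq.
Qed.

End Exchange.

(** * Greedy assignment and condition (a) *)

Section Greedy.
Implicit Types (Rv : V -> R) (c : R) (p j : V) (pre : seq V).

(** Positivity is what the program tests. At the current level it agrees with [radius c <= Rv j],
    because nonzero values come from levels at least [c]. *)
Definition assigned Rv c p : {set V} :=
  [set j in Ball I clients p (delta / 4 * c) | 0 < Rv j].

(** The successor accounts for [j] itself, which is still unassigned when tested. *)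
Definition admissible Rv c j : bool :=
  [forall p, (d p j <= delta / 4 * c) ==> fits c #|assigned Rv c p|.+1].

Definition raise c Rv j : V -> R :=
  if [&& j \in clients, Rv j <= 0 & admissible Rv c j]
  then ([eta Rv with j |-> radius c] : V -> R) else Rv.

(** All positive [c] are covered, not only distances, because (a) ranges over every [t]. *)
Definition load_ok Rv : Prop := forall c p, 0 < c -> fits c #|heavy Rv c p|.

(* The levels above c are complete, and at level c the clients of pre have
   been considered. *)
Definition greedy c pre Rv : Prop :=
  [/\ forall j, Rv j = 0 \/ radius c <= Rv j,
      load_ok Rv,
      forall x y, c < d x y -> saturated Rv (d x y)
    & forall j, j \in pre -> j \in clients -> Rv j < radius c ->
      exists2 p, d p j <= delta / 4 * c & ~~ fits c #|heavy Rv c p|.+1].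

Lemma greedy_init c : (forall x y, d x y <= c) -> greedy c [::] (fun=> 0).
Proof.
move=> cmax; split=> // [|c' p c0|x y].
- by left.
- rewrite /heavy (_ : [set _ in _ | _] = set0).
    by rewrite cards0 /fits mul0r mulr_ge0 // ltW.
  apply/setP => j; rewrite !inE /= [radius _ <= _]leNgt radius_gt0 c0.
  by rewrite andbF.
- by rewrite ltNge cmax.
Qed.

(** No distance lies strictly between [c'] and [c], so the only level to be added to the complete
    ones is [c], where all points have been considered. *)
Lemma greedy_next c c' Rv : c' < c ->
  (forall x y, d x y < c -> d x y <= c') ->
  greedy c (enum V) Rv -> greedy c' [::] Rv.
Proof.
move=> cc dc [Rv0 load sat last]; split=> // [j|x y dxy].
- case: (Rv0 j) => [|cj]; [by left|right].
  by apply: le_trans cj; rewrite radius_le ltW.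
- have [cd|cd|cd] := ltgtP (d x y) c; last first.
  + by rewrite cd => j; apply: last; rewrite mem_enum.
  + exact: sat.
  + by have := dc _ _ cd; rewrite leNgt dxy.
Qed.

Lemma heavy_assigned c Rv p : 0 < c ->
  (forall j, Rv j = 0 \/ radius c <= Rv j) -> assigned Rv c p = heavy Rv c p.
Proof.
move=> c0 Rv0; apply/setP => j; rewrite !inE; congr (_ && _).
have rc : 0 < radius c by rewrite radius_gt0.
case: (Rv0 j) => [->|cj]; first by rewrite ltxx leNgt rc.
by rewrite cj (lt_le_trans rc).
Qed.

(** Raising [j] leaves heavy sets above level [c] unchanged. At or below [c], a heavy set containing
    [j] lies in [j] together with the heavy set of level [c], which admissibility bounds. Earlier
    refusals at level [c] persist because heavy sets only grow. *)
Lemma greedy_raise c pre Rv j : 0 < c ->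
  greedy c pre Rv -> greedy c (rcons pre j) (raise c Rv j).
Proof.
move=> c0 [Rv0 load sat last].
have rc : 0 < radius c by rewrite radius_gt0.
rewrite /raise; case: ifPn => [/and3P[jc Rj adm]|nadm]; last first.
  split=> // i; rewrite mem_rcons inE => /orP[/eqP->|]; last exact: last.
  move=> jc Rj; have Rj0 : Rv j <= 0.
    by case: (Rv0 j) => [->//|]; rewrite leNgt Rj.
  move: nadm; rewrite jc Rj0 /= => /forallPn[p]; rewrite negb_imply.
  by move=> /andP[pj nf]; exists p => //; rewrite -heavy_assigned.
have {}Rj : Rv j = 0.
  by case: (Rv0 j) => // /(lt_le_trans rc); rewrite ltNge Rj.
have heavyE c' p : c < c' ->
    heavy [eta Rv with j |-> radius c] c' p = heavy Rv c' p.
  move=> cc; apply/setP => i; rewrite !inE /=; case: eqVneq => // ->.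
  rewrite Rj radius_le [c' <= c]leNgt cc /=.
  rewrite [radius _ <= _]leNgt radius_gt0 (lt_trans c0 cc).
  by rewrite !andbF.
split.
- by move=> i /=; case: eqVneq => // _; right.
- move=> c' p c'0; have [cc|cc] := ltP c c'.
    by rewrite heavyE //; exact: load.
  have near i : d p i <= delta / 4 * c' -> d p i <= delta / 4 * c.
    by move/le_trans; apply; rewrite ler_pM2l //; dlra.
  have [|jh] := boolP (j \in heavy [eta Rv with j |-> radius c] c' p).
    rewrite !inE => /andP[/andP[_ /near pj] _].
    apply: fits_scale (ltW c'0) cc _.
    have := implyP (forallP adm p) pj; apply: fits_le; first exact: ltW.
    rewrite heavy_assigned //.
    apply: (@leq_trans #|j |: heavy Rv c p|); last first.
      by rewrite cardsU1; case: (_ \notin _).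
    apply/subset_leq_card/subsetP => i; rewrite !inE /=.
    case: eqVneq => //= _ /andP[/andP[-> /near->]] /= ci.
    case: (Rv0 i) ci => [->|->] //.
    by rewrite leNgt radius_gt0 c'0.
  apply: fits_le (load c' p c'0); first exact: ltW.
  apply/subset_leq_card/subsetP => i ih.
  have ij : i != j by apply: contraNneq jh => ij; rewrite -{1}ij.
  by move: ih; rewrite !inE /= (negPf ij).
- move=> x y cd i ic Ri; have [|p pi nf] := sat _ _ cd i ic.
    (* For the raised client the old refusal applies as well, since its old value was 0. *)
    move: Ri => /=; case: eqVneq => // -> _.
    by rewrite Rj radius_gt0 (lt_trans c0).
  by exists p; rewrite ?heavyE.
- move=> i /=; rewrite mem_rcons inE; case: eqVneq => /= [_ _ _|ij ip ic Ri].
    by rewrite ltxx.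
  have [p pi nf] := last i ip ic Ri; exists p => //; apply: contra nf.
  apply: fits_le; first exact: ltW.
  rewrite ltnS; apply/subset_leq_card/subsetP => k; rewrite !inE /=.
  by case: eqVneq => // -> /andP[-> _] /=.
Qed.

(** Every [t > 0] equals [radius c] for [c = 4 * t / (4 + 3 * delta)], and the load condition at
    this [c] is (a) at [t] with denominators cleared. *)
Lemma load_bound Rv (t : R) p : load_ok Rv -> 0 < t ->
  #|[set j in Ball I clients p (delta * t / (4 + 3 * delta)) | t <= Rv j]|%:R
    <= rho * (1 + 3 * delta / 4) ^+ q / (1 - delta / 4) ^+ q * (U / t ^+ q).
Proof.
move=> load t0; pose c := 4 * t / (4 + 3 * delta).
have d3 : 0 < 4 + 3 * delta by dlra.
have c0 : 0 < c by rewrite divr_gt0 // mulr_gt0.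
have d30 : 4 + 3 * delta != 0 by rewrite gt_eqF.
have := load c p c0.
rewrite /fits /heavy (_ : radius c = t); last by rewrite /radius /c; field.
rewrite (_ : delta / 4 * c = delta * t / (4 + 3 * delta)); last first.
  by rewrite /c; field.
have a0 : 0 < 1 + 3 * delta / 4 by dlra.
have b0 : 0 < 1 - delta / 4 by dlra.
have tE : t = (1 + 3 * delta / 4) * c by rewrite /c; field.
clearbody c; rewrite tE.
move: #|_| => n.
rewrite (_ : (4 - delta) / 4 = 1 - delta / 4); last by field.
rewrite !exprMn => le.
have aq : 0 < (1 + 3 * delta / 4) ^+ q by rewrite exprn_gt0.
have bq : 0 < (1 - delta / 4) ^+ q by rewrite exprn_gt0.
have cq : 0 < c ^+ q by rewrite exprn_gt0.
move: aq bq cq le; set a := _ ^+ q; set b := (_ - _) ^+ q; set e := c ^+ q.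
move=> aq bq cq le.
rewrite (_ : _ * (U / _) = rho * U / (b * e)).
  by rewrite ler_pdivlMr ?mulr_gt0.
by field; rewrite !gt_eqF.
Qed.

End Greedy.
End Sparsification.

(** * Sizes of numbers *)

(* All that the analysis uses about the two cost models. *)
Definition size_ok (R : realFieldType) (sz : R -> nat) : Prop :=
  (forall n : nat, (sz n%:R <= n.+1)%N) /\
  (forall o x y, (sz (nop_eval o x y) <= 2 * (sz x + sz y))%N).

(** Cross-multiplying, coprimality makes the reduced numerator and denominator divide [n] and
    [d]. *)
Lemma numq_denq_le (x : rat) (n d : int) :
  d != 0 -> x = n%:~R / d%:~R ->
  (`|numq x| <= `|n|)%N /\ (`|denq x| <= `|d|)%N.
Proof.
move=> d0 xE.
have Q : numq x * d = n * denq x.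
  apply: (@intr_inj rat); rewrite !rmorphM /= numqE {1}xE.
  by field; rewrite intr_eq0.
have E : (`|numq x| * `|d| = `|n| * `|denq x|)%N by rewrite -!abszM Q.
have dp : (0 < `|d|)%N by rewrite absz_gt0.
have cp := coprime_num_den x.
split.
(* Divisibility gives no bound when [n] is 0, but then [numq x] is 0 too. *)
- case: (posnP `|n|) => [n0|np].
    move: E; rewrite n0 mul0n => /eqP; rewrite muln_eq0.
    by rewrite (gtn_eqF dp) orbF => /eqP->.
  apply: dvdn_leq => //.
  by rewrite -(Gauss_dvdl _ cp) -E dvdn_mulr.
- apply: dvdn_leq => //.
  by rewrite -(@Gauss_dvdr _ `|numq x|%N) 1?coprime_sym // E dvdn_mull.
Qed.

Lemma up_log2_mul (a b : nat) : (up_log 2 (a * b) <= up_log 2 a + up_log 2 b)%N.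
Proof.
by apply: up_log_min => //; rewrite expnD leq_mul ?up_logP.
Qed.

Lemma rat_bits_frac (x : rat) (n d : int) (k : nat) :
  d != 0 -> x = n%:~R / d%:~R ->
  (up_log 2 `|n|.+1 <= k)%N -> (up_log 2 `|d|.+1 <= k)%N ->
  (rat_bits x <= 2 * k)%N.
Proof.
move=> d0 xE nk dk; have [nx dx] := numq_denq_le d0 xE.
rewrite mul2n -addnn; apply: leq_add.
  by apply: leq_trans nk; apply: leq_up_log.
by apply: leq_trans dk; apply: leq_up_log.
Qed.

(** Bounds the unreduced numerator of a/b + c/d by a product whose logarithm is at most the sum of
    the sizes of the operands. *)
Lemma cross_lt (a b c d : nat) :
  (a * d + c * b < (a.+1 * b.+1) * (c.+1 * d.+1))%N.
Proof.
rewrite (mulnC c.+1) mulnACA (mulnC b.+1).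
have h x y : (x * y < x.+1 * y.+1)%N by rewrite mulSn mulnS; lia.
apply: leq_trans (leq_mul (h a d) (h c b)); rewrite mulSn mulnS; lia.
Qed.

Lemma mul_lt (a b c d : nat) :
  (a * c < (a.+1 * b.+1) * (c.+1 * d.+1))%N.
Proof.
by rewrite mulnACA -[leqLHS]muln1 leq_mul // ?muln_gt0 // mulSn mulnS; lia.
Qed.

(** Each operation gives an explicit fraction with numerator and denominator below [k1 * k2]; each
    then has at most [rat_bits x + rat_bits y] digits, whence the factor 2. *)
Lemma size_ok_rat : size_ok rat_bits.
Proof.
split=> [n|o x y].
  rewrite /rat_bits pmulrn numq_int denq_int /= -[n.+1 in leqRHS]addn1.
  rewrite leq_add //.
  by apply: up_log_min => //; rewrite ltn_expl.
have dx0 := denq_neq0 x; have dy0 := denq_neq0 y.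
pose k1 := (`|numq x|.+1 * `|denq x|.+1)%N.
pose k2 := (`|numq y|.+1 * `|denq y|.+1)%N.
have kP m : (m < k1 * k2)%N -> (up_log 2 m.+1 <= rat_bits x + rat_bits y)%N.
  move=> mk; apply: leq_trans (leq_up_log 2 mk) _.
  by apply: leq_trans (up_log2_mul _ _) _; apply: leq_add; exact: up_log2_mul.
have q0 z : (denq z)%:~R != 0 :> rat by rewrite intr_eq0 denq_neq0.
pose a := `|numq x|%N; pose b := `|denq x|%N.
pose c := `|numq y|%N; pose d := `|denq y|%N.
have k_add : (a * d + c * b < k1 * k2)%N by exact: cross_lt.
have k_num : (a * c < k1 * k2)%N by exact: mul_lt.
have k_den : (b * d < k1 * k2)%N.
  by rewrite /k1 /k2 (mulnC `|numq x|.+1) (mulnC `|numq y|.+1) mul_lt.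
have fracE : x = (numq x)%:~R / (denq x)%:~R /\ y = (numq y)%:~R / (denq y)%:~R.
  by rewrite !divq_num_den.
case: o => /=.
- apply: (@rat_bits_frac _ (numq x * denq y + numq y * denq x)
            (denq x * denq y)); first by rewrite mulf_neq0.
  + rewrite {1}fracE.1 {1}fracE.2 rmorphD !rmorphM /=.
    by field; rewrite !q0.
  + by apply: kP; lia.
  + by apply: kP; lia.
- apply: (@rat_bits_frac _ (numq x * denq y - numq y * denq x)
            (denq x * denq y)); first by rewrite mulf_neq0.
  + rewrite {1}fracE.1 {1}fracE.2 rmorphB !rmorphM /=.
    by field; rewrite !q0.
  + by apply: kP; lia.
  + by apply: kP; lia.
- apply: (@rat_bits_frac _ (numq x * numq y) (denq x * denq y)).
  + by rewrite mulf_neq0.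
  + rewrite {1}fracE.1 {1}fracE.2 !rmorphM /=.
    by field; rewrite !q0.
  + by apply: kP; lia.
  + by apply: kP; lia.
(* A quotient by 0 is 0, here the divisor itself, whose size is already on the right. *)
- have [->|y0] := eqVneq y 0.
    by rewrite invr0 mulr0; move: (rat_bits x) (rat_bits 0) => m n; lia.
  have ny0 : numq y != 0 by rewrite numq_eq0.
  apply: (@rat_bits_frac _ (numq x * denq y) (denq x * numq y)).
  + by rewrite mulf_neq0.
  + rewrite {1}fracE.1 {1}fracE.2 !rmorphM /=.
    by field; rewrite !q0 ?intr_eq0 ?ny0.
  + by apply: kP; lia.
  + by apply: kP; lia.
Qed.

Lemma size_ok_cost_model (R : realFieldType) (sz : R -> nat) :
  cost_model sz -> size_ok sz.
Proof. by case=> [R'|]; [split|exact: size_ok_rat]. Qed.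

(** * Polynomial running time *)

(** Restricting to [0 < N] makes [N ^ b] monotone in [b], so exponents can be enlarged freely. *)
Definition poly_bounded (f : nat -> nat) : Prop :=
  exists a b, forall N, (0 < N)%N -> (f N <= a * N ^ b)%N.

Lemma poly_bounded_cst k : poly_bounded (fun=> k).
Proof. by exists k, 0%N => N _; rewrite muln1. Qed.

Lemma poly_bounded_id : poly_bounded id.
Proof. by exists 1%N, 1%N => N _; rewrite mul1n expn1. Qed.

Lemma poly_boundedD f g :
  poly_bounded f -> poly_bounded g -> poly_bounded (fun N => f N + g N)%N.
Proof.
move=> [a [b fP]] [a' [b' gP]]; exists (a + a')%N, (b + b')%N => N N0.
rewrite mulnDl leq_add //.
  by apply: leq_trans (fP N N0) _; rewrite leq_mul2l leq_pexp2l ?orbT ?leq_addr.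
by apply: leq_trans (gP N N0) _; rewrite leq_mul2l leq_pexp2l ?orbT ?leq_addl.
Qed.

Lemma poly_boundedM f g :
  poly_bounded f -> poly_bounded g -> poly_bounded (fun N => f N * g N)%N.
Proof.
move=> [a [b fP]] [a' [b' gP]]; exists (a * a')%N, (b + b')%N => N N0.
by rewrite expnD mulnACA leq_mul ?fP ?gP.
Qed.

Lemma poly_boundedS f : poly_bounded f -> poly_bounded (fun N => (f N).+1).
Proof. exact: (poly_boundedD (poly_bounded_cst 1)). Qed.

(* Upper bounds for the size of the value of an expression, and for the cost
   of evaluating it, when all the cells hold numbers of size at most B. *)
Fixpoint nsize (B : nat) (e : nexp) : nat :=
  match e with
  | NConst n => n.+1
  | NCell _ _ _ => B
  | NOp _ e1 e2 => 2 * (nsize B e1 + nsize B e2)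
  end.

Fixpoint ntime (B : nat) (e : nexp) : nat :=
  (1 + nsize B e +
   match e with
   | NConst _ => 0
   | NCell _ i j => icost i + icost j
   | NOp _ e1 e2 => ntime B e1 + ntime B e2
   end)%N.

Fixpoint btime (B : nat) (b : bexp) : nat :=
  (1 + match b with
       | BILt i j => icost i + icost j
       | BNLe e1 e2 => ntime B e1 + ntime B e2
       | BNot b => btime B b
       | BAnd b1 b2 => btime B b1 + btime B b2
       end)%N.

(* Running time when, moreover, every loop makes at most W iterations. *)
Fixpoint ctime (B W : nat) (c : cmd) : nat :=
  match c with
  | Skip => 1
  | SetReg _ e => 1 + icost e
  | SetCell _ i j e => 1 + icost i + icost j + ntime B e
  | Seq c1 c2 => 1 + ctime B W c1 + ctime B W c2
  | If b c1 c2 => 1 + btime B b + (ctime B W c1 + ctime B W c2)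
  | While b c => W.+1 * (1 + btime B b + ctime B W c)
  end.

Definition for_each (x : nat) (c : cmd) : cmd :=
  Seq (SetReg x (IConst 0))
    (While (BILt (IReg x) (IReg 0)) (Seq c (SetReg x (ISucc (IReg x))))).

Section PolyTime.
Variables (B W : nat -> nat).
Hypotheses (polyB : poly_bounded B) (polyW : poly_bounded W).

Ltac poly := repeat first
  [ assumption | exact: poly_bounded_cst
  | apply: poly_boundedD | apply: poly_boundedM | apply: poly_boundedS ].

Lemma nsize_poly e : poly_bounded (fun N => nsize (B N) e).
Proof. by elim: e => [n|_ _ _|_ e1 IH1 e2 IH2] /=; poly. Qed.

Lemma ntime_poly e : poly_bounded (fun N => ntime (B N) e).
Proof.
elim: e => [n|a i j|o e1 IH1 e2 IH2] /=; poly.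
all: by have := nsize_poly.
Qed.

Lemma btime_poly b : poly_bounded (fun N => btime (B N) b).
Proof.
elim: b => [i j|e1 e2|b IH|b1 IH1 b2 IH2] /=; poly.
all: exact: ntime_poly.
Qed.

(** For a fixed program the bound is a fixed expression in sums and products; nesting of loops only
    affects the exponent. *)
Lemma ctime_poly c : poly_bounded (fun N => ctime (B N) (W N) c).
Proof.
elim: c => [|x e|a i j e|c1 IH1 c2 IH2|b c1 IH1 c2 IH2|b c IH] /=; poly.
all: first [exact: ntime_poly | exact: btime_poly].
Qed.

End PolyTime.

(** * Reasoning about programs *)

Section Runs.
Variables (R : realFieldType) (sz : R -> nat) (B W : nat).
Hypothesis szP : size_ok sz.

Definition bounded (s : state R) : Prop :=
  forall a i j, (sz (cell s a i j) <= B)%N.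

(** Total correctness with a time bound read off the syntax, so that reasoning about a particular
    program involves no step counting. *)
Definition runs (c : cmd) (s : state R) (Q : state R -> Prop) : Prop :=
  exists T s', [/\ exec sz c s T s', (T <= ctime B W c)%N & Q s'].

Lemma sz_neval s e : bounded s -> (sz (neval s e) <= nsize B e)%N.
Proof.
move=> bs; elim: e => [n|a i j|o e1 IH1 e2 IH2] /=; last 1 first.
- apply: leq_trans (szP.2 _ _ _) _.
  by rewrite leq_mul2l leq_add.
- exact: szP.1.
- exact: bs.
Qed.

Lemma ncost_le s e : bounded s -> (ncost sz s e <= ntime B e)%N.
Proof.
move=> bs; elim: e => [n|a i j|o e1 IH1 e2 IH2] /=.
- by rewrite !leq_add // szP.1.
- by rewrite !leq_add // bs.
- by rewrite !leq_add //; exact: sz_neval (NOp o e1 e2) bs.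
Qed.

Lemma bcost_le s b : bounded s -> (bcost sz s b <= btime B b)%N.
Proof.
move=> bs; elim: b => [i j|e1 e2|b IH|b1 IH1 b2 IH2] //=; rewrite ?leq_add //.
all: exact: ncost_le.
Qed.

Lemma runs_mono c s (Q Q' : state R -> Prop) :
  runs c s Q -> (forall s', Q s' -> Q' s') -> runs c s Q'.
Proof. by move=> [T [s' [? ? /[swap] QQ /QQ]]]; exists T, s'. Qed.

Lemma runs_skip s (Q : state R -> Prop) : Q s -> runs Skip s Q.
Proof. by exists 1%N, s; split=> //; exact: ESkip. Qed.

Lemma runs_setreg x e s (Q : state R -> Prop) :
  Q (set_reg s x (ieval s e)) -> runs (SetReg x e) s Q.
Proof. by move=> Qs; do 2!eexists; split; [exact: ESetReg|exact: leqnn|]. Qed.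

Lemma runs_setcell a i j e s (Q : state R -> Prop) : bounded s ->
  Q (set_cell s a (ieval s i) (ieval s j) (neval s e)) ->
  runs (SetCell a i j e) s Q.
Proof.
move=> bs Qs; do 2!eexists; split; [exact: ESetCell| |exact: Qs].
by rewrite /= leq_add2l ncost_le.
Qed.

Lemma runs_seq c1 c2 s (Q : state R -> Prop) :
  runs c1 s (fun s' => runs c2 s' Q) -> runs (Seq c1 c2) s Q.
Proof.
move=> [T1 [s1 [e1 t1 [T2 [s2 [e2 t2 Qs]]]]]]; exists (1 + T1 + T2)%N, s2.
by split=> //; [exact: ESeq e1 e2|rewrite /= !leq_add].
Qed.

Lemma runs_if b c1 c2 s (Q : state R -> Prop) : bounded s ->
  (beval s b -> runs c1 s Q) -> (~~ beval s b -> runs c2 s Q) ->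
  runs (If b c1 c2) s Q.
Proof.
move=> bs r1 r2.
have [T [s' [e t Qs]]] : exists T s',
    [/\ exec sz (if beval s b then c1 else c2) s T s',
        (T <= ctime B W c1 + ctime B W c2)%N & Q s'].
  case: ifP => bE.
    have [T [s' [e t Qs]]] := r1 bE.
    by exists T, s'; split=> //; apply: leq_trans t (leq_addr _ _).
  have [T [s' [e t Qs]]] := r2 (negbT bE).
  by exists T, s'; split=> //; apply: leq_trans t (leq_addl _ _).
exists (1 + bcost sz s b + T)%N, s'; split=> //; first exact: EIf.
by rewrite /= !leq_add // bcost_le.
Qed.

(* P k s : the invariant holds in s, and at most k iterations remain. *)
Lemma runs_while b c (P : nat -> state R -> Prop) k s :
  (forall k s, P k s -> bounded s) ->
  (forall k s, P k s -> beval s b ->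
     (0 < k)%N /\ runs c s (fun s' => exists2 k', (k' < k)%N & P k' s')) ->
  P k s -> (k <= W)%N ->
  runs (While b c) s (fun s' => (exists k', P k' s') /\ ~~ beval s' b).
Proof.
move=> Pb Pc Ps kW.
(* The bound is stated with [k] instead of [W] to allow induction; the successor pays for the final
   failing test. *)
suff [T [s' [e t Qs]]] : exists T s', [/\ exec sz (While b c) s T s',
    (T <= k.+1 * (1 + btime B b + ctime B W c))%N
    & (exists k', P k' s') /\ ~~ beval s' b].
  exists T, s'; split=> //; apply: leq_trans t _.
  by rewrite /= leq_mul2r ltnS kW orbT.
elim/ltn_ind: k {kW} s Ps => k IH s Ps.
have bs := bcost_le b (Pb _ _ Ps).
have [bE|bE] := boolP (beval s b); last first.
  exists (1 + bcost sz s b)%N, s; split; first exact: EWhileF.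
    rewrite mulSn -addnA; apply: leq_trans (leq_addr _ _).
    by rewrite leq_add2l; lia.
  by split=> //; exists k.
have [k0 [T1 [s1 [e1 t1 [k' k'k Ps1]]]]] := Pc _ _ Ps bE.
have [T2 [s2 [e2 t2 Qs]]] := IH k' k'k s1 Ps1.
exists (1 + bcost sz s b + T1 + T2)%N, s2; split=> //.
  exact: EWhileT bE e1 e2.
rewrite mulSn !leq_add //; apply: leq_trans t2 _.
by rewrite leq_mul2r k'k orbT.
Qed.

Variable V : finType.

(** The invariant is indexed by the prefix of [enum V] already visited and must be insensitive to
    register [x], which the loop advances. *)
Lemma runs_for x c (P : seq V -> state R -> Prop) s :
  x != 0%N -> (#|V| <= W)%N ->
  (forall pre s, P pre s -> bounded s /\ reg s 0 = #|V|) ->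
  (forall pre s v, P pre s -> P pre (set_reg s x v)) ->
  (forall pre p s, P pre s -> reg s x = enum_rank p ->
     (size pre < #|V|)%N ->
     runs c s (fun s' => P (rcons pre p) s' /\ reg s' x = enum_rank p)) ->
  P [::] s ->
  runs (for_each x c) s (P (enum V)).
Proof.
move=> x0 VW Pb Px Pc Ps.
have size_enum : size (enum V) = #|V| by rewrite -cardT.
pose P' k s := exists2 i, (k + i)%N = #|V|
  & reg s x = i /\ P (take i (enum V)) s.
apply: runs_seq; apply: runs_setreg => /=.
have Ps' : P' #|V| (set_reg s x 0).
  by exists 0%N; rewrite ?addn0 //= eqxx take0; split=> //; exact: Px.
apply: (runs_mono (@runs_while _ _ P' _ _ _ _ Ps' VW)).
- by move=> k s1 [i _ [_ /Pb[]]].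
- move=> k s1 [i ki [xi Pi]] /=; have [_ ->] := Pb _ _ Pi; rewrite xi => iV.
  have k0 : (0 < k)%N by lia.
  split=> //.
  have [p pE] : exists p : V, i = enum_rank p.
    by exists (enum_val (Ordinal iV)); rewrite enum_valK.
  have nthi : nth p (enum V) i = p by rewrite pE nth_enum_rank.
  have pre_lt : (size (take i (enum V)) < #|V|)%N.
    by rewrite size_take size_enum iV.
  have rc := Pc _ p _ Pi (etrans xi pE) pre_lt.
  apply: runs_seq; apply: runs_mono rc _ => s2 [Ps2 xs2].
  apply: runs_setreg => /=.
  exists k.-1; first by rewrite prednK.
  exists i.+1; first by lia.
  rewrite /= eqxx xs2 -pE; split=> //; apply: Px.
  by rewrite (take_nth p) ?size_enum // nthi.
- move=> s1 [[k [i ki [xi Pi]]]] /=; have [_ ->] := Pb _ _ Pi.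
  rewrite xi -leqNgt => iV; have iE : i = #|V| by lia.
  by move: Pi; rewrite iE -size_enum take_size.
Qed.

End Runs.

(** * The greedy algorithm as a program *)

(* Array 6 holds the scalars: the current level, the largest distance found
   by a scan, a counter, and the outcome of a test. *)
Definition scalar (k : nat) : nexp := NCell 6 (IConst k) (IConst 0).
Definition set_scalar (k : nat) (e : nexp) : cmd :=
  SetCell 6 (IConst k) (IConst 0) e.
Definition param (k : nat) : nexp := NCell 4 (IConst k) (IConst 0).
Definition distance (x y : nat) : nexp := NCell 0 (IReg x) (IReg y).
Definition bound_at (x : nat) : nexp := NCell 5 (IReg x) (IConst 0).

Definition is_client (x : nat) : bexp :=
  BNLe (NConst 1) (NCell 2 (IReg x) (IConst 0)).
Definition is_assigned (x : nat) : bexp :=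
  BNot (BNLe (bound_at x) (NConst 0)).
Definition is_near (x y : nat) : bexp :=
  BNLe (distance x y)
    (NOp NMul (NOp NDiv (param 3) (NConst 4)) (scalar 0)).

Fixpoint npow (e : nexp) (n : nat) : nexp :=
  if n is n'.+1 then NOp NMul e (npow e n') else NConst 1.

Definition is_fitting (q : nat) : bexp :=
  BNLe
    (NOp NMul (scalar 2)
       (npow (NOp NMul (NOp NDiv (NOp NSub (NConst 4) (param 3)) (NConst 4))
                (scalar 0)) q))
    (NOp NMul (param 2) (param 4)).

Definition radius_exp : nexp :=
  NOp NMul
    (NOp NDiv (NOp NAdd (NConst 4) (NOp NMul (NConst 3) (param 3))) (NConst 4))
    (scalar 0).

(** Registers 1, 2 and 3 hold the candidate client, the centre of the ball and the client being
    counted. *)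
Definition count_assigned : cmd :=
  for_each 3
    (If (BAnd (is_client 3) (BAnd (is_near 2 3) (is_assigned 3)))
       (set_scalar 2 (NOp NAdd (scalar 2) (NConst 1))) Skip).

(** The counter starts at 1 for the candidate itself. Scalar 3 is set to 1 by the caller and cleared
    by any ball without room. *)
Definition test_admissible (q : nat) : cmd :=
  for_each 2
    (If (is_near 2 1)
       (Seq (set_scalar 2 (NConst 1))
          (Seq count_assigned
             (If (is_fitting q) Skip (set_scalar 3 (NConst 0)))))
       Skip).

Definition level (q : nat) : cmd :=
  for_each 1
    (If (BAnd (is_client 1) (BNot (is_assigned 1)))
       (Seq (set_scalar 3 (NConst 1))
          (Seq (test_admissible q)
             (If (BNLe (NConst 1) (scalar 3))
                (SetCell 5 (IReg 1) (IConst 0) radius_exp) Skip)))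
       Skip).

(* Scalar 1 becomes the largest distance below the current level; level 0
   stands for infinity. *)
Definition scan : cmd :=
  for_each 1 (for_each 2
    (If (BAnd (BNot (BNLe (distance 1 2) (scalar 1)))
           (BNot (BAnd (BNLe (scalar 0) (distance 1 2))
                    (BNot (BNLe (scalar 0) (NConst 0))))))
       (set_scalar 1 (distance 1 2)) Skip)).

Definition next_level : cmd :=
  Seq (set_scalar 1 (NConst 0)) (Seq scan (set_scalar 0 (scalar 1))).

(** Level 0 means infinity only at the first call of [next_level], on the initial memory; afterwards
    it means that no positive distance is left, and the loop stops. *)
Definition sparsify (q : nat) : cmd :=
  Seq next_level
    (While (BNot (BNLe (scalar 0) (NConst 0))) (Seq (level q) next_level)).

Lemma neval_npow (R : realFieldType) (s : state R) e n :
  neval s (npow e n) = neval s e ^+ n.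
Proof. by elim: n => [|n IH] //=; rewrite IH exprS. Qed.

Lemma beval_and (R : realFieldType) (s : state R) b1 b2 :
  beval s (BAnd b1 b2) = beval s b1 && beval s b2.
Proof. by []. Qed.

Lemma beval_not (R : realFieldType) (s : state R) b :
  beval s (BNot b) = ~~ beval s b.
Proof. by []. Qed.

(* The bounds R_j are the largest numbers ever stored. *)
Definition cell_size (N : nat) : nat := nsize N radius_exp.

(** * Correctness of the program and sizes of its numbers *)

Section Correctness.
Variables (R : realFieldType) (sz : R -> nat).
Hypothesis szP : size_ok sz.
Variables (V : finType) (I : instance R V) (q : nat) (rho delta U : R).

Local Notation d := (dist I).
Local Notation clients := (clients I).
Local Notation N := (input_size sz I rho delta U).
Local Notation B := (cell_size N).
Local Notation runs := (runs sz B N).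
Local Notation rank p := (nat_of_ord (enum_rank p)).
Local Notation scal s k := (cell s 6 k 0).
Local Notation radius := (radius delta).
Local Notation greedy := (greedy I q rho delta U).

Lemma size_parameters x : x \in parameters I rho delta U -> (sz x < N)%N.
Proof.
rewrite /input_size -[(sz x).+1]/(1 + sz x)%N => xP.
by apply: leq_trans (leq_addl _ _); rewrite (big_rem x) //= leq_addr.
Qed.

Lemma size_dist x y : (sz (d x y) < N)%N.
Proof.
rewrite /input_size -addnA; apply: leq_trans (leq_addr _ _).
by rewrite (bigD1 x) //= (bigD1 y) //= -!addnA leq_addr.
Qed.

(** The input lists all pairs of points, so its size bounds the number of levels and the values of
    the counters. *)
Lemma size_points : (#|V| * #|V| + 3 * #|V| + 5 <= N)%N.
Proof.
rewrite /input_size !leq_add //; last by rewrite !big_cons big_nil; lia.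
rewrite -sum_nat_const; apply: leq_sum => x _.
by rewrite -sum1_card; apply: leq_sum => y _; rewrite leq_addr.
Qed.

Lemma leN_cell_size : (N <= B)%N.
Proof. by rewrite /cell_size /=; lia. Qed.

Lemma size_nat n : (n < N)%N -> (sz n%:R <= B)%N.
Proof.
by move=> nN; apply: leq_trans leN_cell_size; apply: leq_trans nN; exact: szP.1.
Qed.

Lemma size_bool (b : bool) : (sz b%:R <= B)%N.
Proof. by apply: size_nat; have := size_points; case: b; lia. Qed.

(** Follows the evaluation of [radius_exp], from which [B] is defined. A level is a copy of an input
    distance, so sizes do not compound over the iterations. *)
Lemma size_radius x y : (sz (radius (d x y)) <= B)%N.
Proof.
have szD : (sz delta <= N)%N.
  by rewrite ltnW // size_parameters // !inE eqxx !orbT.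
have opP o a b m n : (sz a <= m)%N -> (sz b <= n)%N ->
    (sz (nop_eval o a b) <= 2 * (m + n))%N.
  by move=> am bn; apply: leq_trans (szP.2 _ _ _) _; rewrite leq_mul2l leq_add.
have sz1 := opP NMul _ _ _ _ (szP.1 3%N) szD.
have sz2 := opP NAdd _ _ _ _ (szP.1 4%N) sz1.
have sz3 := opP NDiv _ _ _ _ sz2 (szP.1 4%N).
exact: opP NMul _ _ _ _ sz3 (ltnW (size_dist x y)).
Qed.

(** The input arrays stay intact and array 5 represents [Rv]; the scalars of array 6 are constrained
    only in size. *)
Definition inv (s : state R) (Rv : V -> R) : Prop :=
  [/\ reg s 0 = #|V|,
      forall a i j, (a < 5)%N ->
        cell s a i j = cell (input I rho delta U) a i j,
      forall p, cell s 5 (rank p) 0 = Rv p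
    & bounded sz B s].

Lemma onth_rank (p : V) : onth (enum V) (rank p) = Some p.
Proof.
by rewrite onthE (nth_map p) ?nth_enum_rank // -cardT ltn_ord.
Qed.

Section State.
Variables (s : state R) (Rv : V -> R).
Hypothesis sP : inv s Rv.

Lemma cell_dist x y : cell s 0 (rank x) (rank y) = d x y.
Proof. by case: sP => _ -> //; rewrite /= /dist_cells !onth_rank. Qed.

Lemma cell_client x : cell s 2 (rank x) 0 = (x \in clients)%:R.
Proof. by case: sP => _ -> //; rewrite /= /flag_cells onth_rank. Qed.

Lemma cell_param k : cell s 4 k 0 = nth 0 (parameters I rho delta U) k.
Proof. by case: sP => _ ->. Qed.

Lemma inv_set_scalar k v : (sz v <= B)%N -> inv (set_cell s 6 k 0 v) Rv.
Proof.
case: sP => r0 cin cR bs vB; split=> //= [a i j a5|a i j].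
  by rewrite (ltn_eqF (@ltn_trans 5 a 6 a5 isT)) cin.
by move=> /=; case: ifP => _ //; exact: bs.
Qed.

Lemma inv_set_bound j v : (sz v <= B)%N ->
  inv (set_cell s 5 (rank j) 0 v) [eta Rv with j |-> v].
Proof.
case: sP => r0 cin cR bs vB; split=> //= [a i k a5|p|a i k].
- by rewrite (ltn_eqF a5) ?cin.
- by rewrite andbT cR val_eqE (inj_eq enum_rank_inj).
- by move=> /=; case: ifP => _ //; exact: bs.
Qed.

Lemma is_client_ok x j : reg s x = rank j ->
  beval s (is_client x) = (j \in clients).
Proof.
by move=> /= ->; rewrite cell_client; case: (_ \in _); rewrite ?lexx // ler10.
Qed.

Lemma is_assigned_ok x j : reg s x = rank j ->
  beval s (is_assigned x) = (0 < Rv j).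
Proof. by move=> /= ->; case: sP => _ _ -> _; rewrite ltNge. Qed.

Lemma is_near_ok x y p j : reg s x = rank p -> reg s y = rank j ->
  beval s (is_near x y) = (d p j <= delta / 4 * scal s 0).
Proof. by move=> /= -> ->; rewrite cell_dist cell_param. Qed.

Lemma is_fitting_ok n : scal s 2 = n%:R ->
  beval s (is_fitting q) = fits q rho delta U (scal s 0) n.
Proof. by move=> /= ->; rewrite neval_npow /= !cell_param. Qed.

End State.

Lemma inv_bounded s Rv : inv s Rv -> bounded sz B s. Proof. by case. Qed.

Lemma pointsN : (#|V| <= N)%N. Proof. have := size_points; lia. Qed.

Lemma runs_count_assigned s Rv (j p : V) :
  inv s Rv -> scal s 2 = 1 -> reg s 1 = rank j -> reg s 2 = rank p ->
  runs count_assigned s (fun s' =>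
    [/\ inv s' Rv, scal s' 0 = scal s 0, scal s' 3 = scal s 3,
        scal s' 2 = #|assigned I delta Rv (scal s 0) p|.+1%:R
      & reg s' 1 = rank j /\ reg s' 2 = rank p]).
Proof.
move=> sP s2 r1 r2; pose a i := i \in assigned I delta Rv (scal s 0) p.
pose P pre s' := [/\ inv s' Rv, scal s' 0 = scal s 0, scal s' 3 = scal s 3,
  scal s' 2 = (count a pre).+1%:R & reg s' 1 = rank j /\ reg s' 2 = rank p].
have PV s' : P (enum V) s' -> [/\ inv s' Rv, scal s' 0 = scal s 0,
    scal s' 3 = scal s 3, scal s' 2 = #|assigned I delta Rv (scal s 0) p|.+1%:R
    & reg s' 1 = rank j /\ reg s' 2 = rank p].
  rewrite /P (_ : count a (enum V) = #|assigned I delta Rv (scal s 0) p|) //.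
  rewrite -size_filter enumT cardE; congr size; exact: eq_filter.
apply: runs_mono PV; apply: runs_for => //.
- exact: pointsN.
- by move=> pre s' [s'P _ _ _ _]; case: s'P.
- move=> pre i s' [s'P c0 c3 c2 [r1' r2']] r3 prelt.
  have bs := inv_bounded s'P.
  have aE : beval s' (BAnd (is_client 3) (BAnd (is_near 2 3) (is_assigned 3)))
      = a i.
    rewrite !beval_and (is_client_ok s'P r3) (is_near_ok s'P r2' r3).
    by rewrite (is_assigned_ok s'P r3) /a !inE c0 andbA.
  have cnt : (count a pre <= #|V|)%N.
    by apply: leq_trans (count_size _ _) (ltnW prelt).
  apply: runs_if => //; rewrite aE => ai; last first.
    apply: runs_skip; split=> //; split=> //.
    by rewrite -cats1 count_cat /= (negPf ai) /= !addn0.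
  apply: runs_setcell => //=; split=> //; split=> //=.
  + apply: inv_set_scalar => //; rewrite c2 -natrD; apply: size_nat.
    by have := size_points; lia.
  + by rewrite c2 -natrD -cats1 count_cat /= ai !addn0 !addn1.
Qed.

Lemma runs_test_admissible s Rv j :
  inv s Rv -> scal s 3 = 1 -> reg s 1 = rank j ->
  runs (test_admissible q) s (fun s' =>
    [/\ inv s' Rv, scal s' 0 = scal s 0,
        scal s' 3 = (admissible I q rho delta U Rv (scal s 0) j)%:R
      & reg s' 1 = rank j]).
Proof.
move=> sP s3 r1; pose c := scal s 0.
pose a p := (d p j <= delta / 4 * c) ==>
  fits q rho delta U c #|assigned I delta Rv c p|.+1.
pose P pre s' := [/\ inv s' Rv, scal s' 0 = c, scal s' 3 = (all a pre)%:R
  & reg s' 1 = rank j].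
have PV s' : P (enum V) s' -> [/\ inv s' Rv, scal s' 0 = c,
    scal s' 3 = (admissible I q rho delta U Rv c j)%:R & reg s' 1 = rank j].
  rewrite /P (_ : all a (enum V) = admissible I q rho delta U Rv c j) //.
  apply/allP/forallP => [h p|h p _]; last exact: h.
  by apply: h; rewrite mem_enum.
apply: runs_mono PV; apply: runs_for => //.
- exact: pointsN.
- by move=> pre s' [s'P _ _ _]; case: s'P.
move=> pre p s' [s'P c0 c3 r1'] r2 _; have bs := inv_bounded s'P.
apply: runs_if => //; rewrite (is_near_ok s'P r2 r1') c0 => near; last first.
  by apply: runs_skip; rewrite /P all_rcons {1}/a (negPf near).
apply: runs_seq; apply: runs_setcell => //=.
set s1 := set_cell _ _ _ _ _.
have s1P : inv s1 Rv by apply: inv_set_scalar => //; exact: (size_bool true).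
apply: runs_seq.
apply: runs_mono (runs_count_assigned s1P _ r1' r2) _ => //.
move=> s2 [s2P]; rewrite /= c0 c3 => d0 d3 d2 [r1'' r2''].
have bs2 := inv_bounded s2P.
have aE : beval s2 (is_fitting q) = a p.
  by rewrite (is_fitting_ok s2P d2) d0 /a near.
apply: runs_if => //; rewrite aE => ap.
  by apply: runs_skip; rewrite /P all_rcons ap.
apply: runs_setcell => //=; split=> //; split=> //=.
- by apply: inv_set_scalar => //; exact: (size_bool false).
- by rewrite all_rcons (negPf ap).
Qed.

Hypotheses (rho_gt0 : 0 < rho) (delta_gt0 : 0 < delta).
Hypotheses (delta_lt : delta < 2^-1) (U_ge0 : 0 <= U).

(** One pass of the loop body carries out [raise], so [greedy_raise] preserves the loop
    invariant. *)
Lemma runs_level s Rv x y : 0 < d x y ->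
  inv s Rv -> scal s 0 = d x y -> greedy (d x y) [::] Rv ->
  runs (level q) s (fun s' => exists Rv',
    [/\ inv s' Rv', scal s' 0 = d x y & greedy (d x y) (enum V) Rv']).
Proof.
move=> d0 sP s0 gP.
pose P pre s' := exists Rv',
  [/\ inv s' Rv', scal s' 0 = d x y & greedy (d x y) pre Rv'].
apply: (runs_for szP (P := P)) => //; last by exists Rv.
- exact: pointsN.
- by move=> pre s' [Rv' [s'P _ _]]; case: s'P.
move=> pre j s' [Rv' [s'P c0 g'P]] r1 _; have bs := inv_bounded s'P.
have := greedy_raise rho_gt0 delta_gt0 delta_lt j d0 g'P.
rewrite /raise => gadm.
have tE : beval s' (BAnd (is_client 1) (BNot (is_assigned 1)))
    = (j \in clients) && (Rv' j <= 0).
  rewrite beval_and beval_not (is_client_ok s'P r1).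
  by rewrite (is_assigned_ok s'P r1) leNgt.
apply: runs_if => //; rewrite tE => t; last first.
  apply: runs_skip; split=> //; exists Rv'; split=> //.
  by move: gadm; rewrite andbA (negPf t).
apply: runs_seq; apply: runs_setcell => //=.
set s1 := set_cell _ _ _ _ _.
have s1P : inv s1 Rv' by apply: inv_set_scalar => //; exact: (size_bool true).
apply: runs_seq; apply: runs_mono (runs_test_admissible s1P _ r1) _ => //.
move=> s2 [s2P]; rewrite /= c0 => d0' d3 r1'; have bs2 := inv_bounded s2P.
rewrite andbA t /= in gadm.
apply: runs_if => //=; rewrite d3.
  case: admissible gadm; last by rewrite ler10.
  move=> gadm _; apply: runs_setcell => //=; split=> //.
  rewrite r1' d0' (cell_param s2P) /=.
  eexists; split; [|by []|exact: gadm].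
  by apply: inv_set_bound => //; exact: size_radius.
case: admissible gadm; first by rewrite lexx.
by move=> gadm _; apply: runs_skip; split=> //; exists Rv'.
Qed.

(** The premises [0 < scal s 0] encode the convention that level 0 stands for infinity. *)
Lemma runs_next_level s Rv :
  inv s Rv ->
  runs next_level s (fun s' => exists c',
    [/\ inv s' Rv, scal s' 0 = c',
        0 <= c' /\ (c' = 0 \/ exists x y, c' = d x y /\
                    (0 < scal s 0 -> c' < scal s 0))
      & forall x y, (0 < scal s 0 -> d x y < scal s 0) -> d x y <= c']).
Proof.
move=> sP; set c := scal s 0.
(* [A] holds the pairs scanned so far; 0 is the initial maximum. *)
pose best (A : V -> V -> Prop) (b : R) :=
  [/\ 0 <= b, b = 0 \/ exists x y, b = d x y /\ (0 < c -> b < c)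
    & forall x y, A x y -> (0 < c -> d x y < c) -> d x y <= b].
pose P (pre : seq V) s' := [/\ inv s' Rv, scal s' 0 = c
  & best (fun x _ => x \in pre) (scal s' 1)].
have bs := inv_bounded sP; apply: runs_seq; apply: runs_setcell => //=.
set s1 := set_cell _ _ _ _ _.
have s1P : inv s1 Rv.
  by apply: inv_set_scalar => //; exact: (size_bool false).
apply: runs_seq; suff H : runs scan s1 (P (enum V)).
  apply: runs_mono H _ => s' [s'P c0 [b0 bd bmax]].
  have bs' := inv_bounded s'P.
  apply: runs_setcell => //=; exists (scal s' 1); split=> //.
    by apply: inv_set_scalar => //; exact: bs'.
  by move=> x y; apply: bmax; rewrite mem_enum.
apply: runs_for => //; last by split=> //; split=> //; left.
- exact: pointsN.
- by move=> pre s' [s'P _ _]; case: s'P.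
move=> pre x s' [s'P c0 bP] r1 _.
pose P' (pre' : seq V) s' := [/\ inv s' Rv, scal s' 0 = c, reg s' 1 = rank x
  & best (fun z y => z \in pre \/ z = x /\ y \in pre') (scal s' 1)].
have PV s2 : P' (enum V) s2 -> P (rcons pre x) s2 /\ reg s2 1 = rank x.
  move=> [s2P e0 r1' [b0 bd bmax]]; split=> //; split=> //; split=> // z y zP.
  apply: bmax; move: zP; rewrite mem_rcons inE mem_enum.
  by case/orP => [/eqP|]; [right|left].
apply: runs_mono PV; apply: runs_for => //; last first.
- split=> //; case: bP => b0 bd bmax; split=> // z y [zP|[]//].
  exact: bmax.
- move=> pre' y s2 [s2P e0 r1' [b0 bd bmax]] r2 _; have bs2 := inv_bounded s2P.
  apply: runs_if => //=; rewrite r1' r2 (cell_dist s2P) e0 -!ltNge.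
    rewrite negb_and -!ltNge -leNgt => /andP[bxy cxy].
    have cxy' : 0 < c -> d x y < c.
      by case/orP: cxy => //; rewrite leNgt => /negP.
    apply: runs_setcell => //=; rewrite r1' r2 (cell_dist s2P).
    split=> //; split=> //=; first apply: inv_set_scalar => //.
      by apply: leq_trans leN_cell_size; exact: ltnW (size_dist x y).
    split; [exact: dist_ge0|by right; exists x, y|] => z w zw zc.
    move: zw; rewrite mem_rcons inE => -[zP|[zx /orP[/eqP wy|wP]]].
    + by apply: le_trans (ltW bxy); apply: bmax => //; left.
    + by rewrite zx wy.
    + by apply: le_trans (ltW bxy); apply: bmax => //; right.
  rewrite negb_and negbK -leNgt => nb.
  apply: runs_skip; split=> //; split=> //; split=> // z w zw zc.
  move: zw; rewrite mem_rcons inE => -[zP|[zx /orP[/eqP wy|wP]]].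
  + by apply: bmax => //; left.
  + move: zc; rewrite zx wy => zc; case/orP: nb => // /andP[cd /zc].
    by rewrite ltNge cd.
  + by apply: bmax => //; right.
- by move=> pre' s2 [s2P _ _ _]; case: s2P.
- exact: pointsN.
Qed.

Lemma inv_input : inv (input I rho delta U) (fun=> 0).
Proof.
have sz0 := size_bool false.
have flagB A i : (sz (flag_cells R A i) <= B)%N.
  by rewrite /flag_cells; case: onth => [p|//]; exact: size_bool.
split=> // a i j /=.
case: a => [|[|[|[|[|a]]]]]; try by case: j.
- rewrite /dist_cells; case: onth => [x|//]; case: onth => [y|//].
  by apply: leq_trans leN_cell_size; exact: ltnW (size_dist x y).
- case: j => //; have [i5|i5] := ltnP i (size (parameters I rho delta U)).
    apply: leq_trans leN_cell_size; apply/ltnW/size_parameters.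
    exact: mem_nth.
  by rewrite nth_default.
Qed.

Lemma runs_sparsify :
  runs (sparsify q) (input I rho delta U)
    (fun s' => exists2 Rv, inv s' Rv & greedy 0 [::] Rv).
Proof.
(* Termination measure: the pairs at positive distance up to the current level. A pair attaining the
   level drops out at each iteration. *)
pose pairs c := [set z : V * V | 0 < d z.1 z.2 <= c].
pose P k s := exists Rv, [/\ inv s Rv, greedy (scal s 0) [::] Rv,
  scal s 0 = 0 \/ exists x y, scal s 0 = d x y & k = #|pairs (scal s 0)|].
have leqN c : (#|pairs c| <= N)%N.
  apply: leq_trans (max_card _) _; rewrite card_prod.
  by have := size_points; lia.
apply: runs_seq; apply: runs_mono (runs_next_level inv_input) _.
move=> s [c [sP s0 [c0 cd] cmax]].
have Ps : P #|pairs c| s.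
  exists (fun=> 0); rewrite s0; split=> //.
    by apply: greedy_init => // x y; apply: cmax; rewrite /= ltxx.
  by case: cd => [|[x [y [cE _]]]]; [left|right; exists x, y].
apply: runs_mono (runs_while szP _ _ Ps (leqN c)) _ => //.
- by move=> k s1 [Rv [s1P _ _ _]]; exact: inv_bounded s1P.
- move=> k s1 [Rv [s1P gP s1d kE]] /=; rewrite -ltNge => s1_gt0.
  have [x [y s1E]] : exists x y, scal s1 0 = d x y.
    by case: s1d s1_gt0 => // ->; rewrite ltxx.
  have xyP : (x, y) \in pairs (scal s1 0) by rewrite inE /= -s1E s1_gt0 lexx.
  split; first by rewrite kE; apply/card_gt0P; exists (x, y).
  rewrite s1E in s1_gt0 gP.
  apply: runs_seq; apply: runs_mono (runs_level s1_gt0 s1P s1E gP) _.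
  move=> s2 [Rv2 [s2P s2E g2P]].
  apply: runs_mono (runs_next_level s2P) _ => s3 [c' [s3P s3E [c'0 c'd] c'max]].
  rewrite s2E in c'd c'max.
  have c'lt : c' < d x y by case: c'd => [->//|[x' [y' [_]]]]; exact.
  exists #|pairs c'|.
    rewrite kE s1E; apply/proper_card/properP; split.
      apply/subsetP => z; rewrite !inE => /andP[-> zc].
      exact: le_trans zc (ltW c'lt).
    by exists (x, y); rewrite !inE /= ?s1_gt0 ?lexx // -ltNge.
  exists Rv2; rewrite s3E; split=> //.
    by apply: greedy_next g2P => // x' y' lt; apply: c'max.
  by case: c'd => [|[x' [y' [cE _]]]]; [left|right; exists x', y'].
(* On exit the level is at most 0, and being 0 or a distance it equals 0. *)
- move=> s' [[k [Rv [s'P gP s'd _]]]] /=; rewrite negbK => s'0.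
  exists Rv => //; suff <- : scal s' 0 = 0 by [].
  case: s'd => // -[x [y s'E]]; apply/eqP; rewrite eq_le s'0 s'E.
  exact: dist_ge0.
Qed.

End Correctness.

Theorem theorem5 (q : nat) (hq : q = 1%N \/ q = 2%N) :
  exists (prog : cmd) (a b : nat),
  forall (R : realFieldType) (sz : R -> nat), cost_model sz ->
  forall (V : finType) (I : instance R V) (rho delta U U' : R)
    (Sstar Cstar : {set V}) (kappa : V -> V),
    0 < rho < 2^-1 -> 0 < delta < 2^-1 -> 0 <= U ->
    solution I Sstar Cstar kappa -> nearest I Sstar kappa ->
    U' = cost I q Cstar kappa -> U' <= U ->
    sparse I q rho delta U Sstar Cstar kappa ->
  exists (T : nat) (final : state R) (Rv : V -> R),
    [/\ exec sz prog (input I rho delta U) T final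
          /\ (T <= a * input_size sz I rho delta U ^ b)%N,
        forall j, j \in clients I -> Rv j = output final j /\ 0 <= Rv j,
        forall (t : R) (p : V), 0 < t ->
          #|[set j in Ball I (clients I) p (delta * t / (4 + 3 * delta))
             | t <= Rv j]|%:R
          <= rho * (1 + 3 * delta / 4) ^+ q / (1 - delta / 4) ^+ q
             * (U / t ^+ q)
      & exists (S D : {set V}) (sigma : V -> V),
          [/\ solution I S D sigma,
              cost I q D sigma <= (1 + delta / 2) ^+ q * U',
              forall j, j \in D -> dist I (sigma j) j <= Rv j
            & forall i, i \in facilities I :\: preopened I ->
                \sum_(j in D | sigma j == i) dist I j i ^+ q
                  <= rho * (1 + delta / 2) ^+ q * U]].
Proof.
(* The exponents are fixed before any field or instance, hence depend on [q] alone. *)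
have [a [b ab]] : poly_bounded (fun N => ctime (cell_size N) N (sparsify q)).
  exact: ctime_poly (nsize_poly poly_bounded_id _) poly_bounded_id _.
exists (sparsify q), a, b => R sz /size_ok_cost_model szP V I rho delta U U'.
move=> S C kappa /andP[rho0 _] /andP[delta0 delta_lt] U0 solC near -> _ spC.
(* At level 0 the greedy invariant gives saturation at every positive distance, as the exchange
   argument requires. *)
have [T [s [ex Tle [Rv sP [Rv0 load sat _]]]]] :=
  runs_sparsify szP I q rho0 delta0 delta_lt U0.
have Rv_ge0 j : 0 <= Rv j by case: (Rv0 j) => [->//|]; rewrite radius0.
exists T, s, Rv; split.
- split=> //; apply: leq_trans Tle (ab _ _).
  by have := size_points sz I rho delta U; lia.
- by move=> j _; split=> //; case: sP => _ _ cR _; rewrite /output cR.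
- by move=> t p t0; apply: load_bound.
- exact: (exchange_solution rho0 delta0 delta_lt U0 solC near spC).
Qed.
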